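(* Let $n=2k$ with $k\ge1$ and let $A_n$ be the connected anti-regular graph on $n$ vertices. For a real number $\lambda\notin\{0,-1\}$, $\lambda$ is an eigenvalue of $A_n$ if and only if, setting $\theta=\arccos\left(\frac{1-2\lambda-2\lambda^2}{2\lambda(\lambda+1)}\right)$ (in particular the argument lies in $[-1,1]$), one has $\sin(k\theta)+\sin((k-1)\theta)\neq0$ and \[\lambda=\frac{\sin(k\theta)}{\sin(k\theta)+\sin((k-1)\theta)}.\]
   Context: A simple graph is anti-regular if exactly two of its vertices have the same degree. For each $n\ge2$, $A_n$ denotes the unique (up to isomorphism) connected anti-regular graph on $n$ vertices; for $n$ even it is the threshold graph with creation sequence $(0,1,0,1,\dots,0,1)$, where a $1$ means the new vertex is joined to all previous vertices and a $0$ means it is added isolated. Eigenvalues are those of the adjacency matrix; $-1$ is known to be an eigenvalue of $A_{2k}$ and $0$ is not. $\arccos:[-1,1]\to[0,\pi]$. *)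

(* Defs.v *)
From HB Require Import structures.
From mathcomp Require Import all_boot all_order all_algebra.
From mathcomp Require Import all_classical all_reals all_analysis.
Set Implicit Arguments.
Unset Strict Implicit.
Unset Printing Implicit Defensive.
Import Order.TTheory GRing.Theory Num.Theory.

Local Open Scope ring_scope.

(* A simple graph on the vertex set T is a symmetric irreflexive e : rel T. *)

Definition degree (T : finType) (e : rel T) (x : T) : nat :=
  #|[set y | e x y]|.

Definition connected_graph (T : finType) (e : rel T) : Prop :=
  forall x y : T, connect e x y.

(* Exactly one unordered pair of distinct vertices has equal degrees; all
   other pairs of distinct vertices have different degrees. *)
Definition antiregular (T : finType) (e : rel T) : Prop :=
  exists u v : T,
    [/\ u != v,
        degree e u = degree e v &
        forall x y : T, x != y -> degree e x = degree e y ->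
          [set x; y]%SET = [set u; v]%SET].

Definition adjacency_mx (R : realType) (T : finType) (e : rel T) :
    'M[R]_#|T| :=
  \matrix_(i, j) (e (enum_val i) (enum_val j))%:R.

(* Main.v *)
(* In a connected anti-regular graph on 2k vertices some vertex a is adjacent to
   all others and some b <> a is adjacent to a only; deleting both leaves a graph
   of the same kind, so the graph is exhausted by k such deletions.  Along them
   the eigenvector equations determine x a and x b in turn, and reduce to a
   linear recursion on pairs (s, t) with t = s at the end.  Its matrix has
   determinant 1 and trace -2c, so the pairs are Chebyshev values U_n(c) up to
   signs and factors, and the final condition reads
   U_{k-1} = lambda (U_{k-1} + U_{k-2}).  If |c| >= 1 then |U_n| is strictly
   increasing, which makes this condition impossible; if |c| < 1 then
   U_{n-1}(cos theta) = sin (n theta) / sin theta. *)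
Require Import Defs.
From HB Require Import structures.
From mathcomp Require Import all_boot all_order all_algebra.
From mathcomp Require Import all_classical all_reals all_analysis.
From mathcomp Require Import fintype finset zify ring lra.
Set Implicit Arguments.
Unset Strict Implicit.
Unset Printing Implicit Defensive.
Import Order.TTheory GRing.Theory Num.Theory.

Local Open Scope ring_scope.

(** * Structure of connected anti-regular graphs *)

(** Each step adds a vertex [b] isolated from [S], then a vertex [a] joined to everything present:
    the creation sequence 0, 1, ..., 0, 1 of a threshold graph. *)
Inductive peelable (T : finType) (e : rel T) : nat -> {set T} -> Prop :=
| peelable0 : peelable e 0 set0
| peelableS k (S : {set T}) a b :
    a \notin S -> b \notin a |: S -> e a b ->
    {in S, forall x, e a x} -> {in S, forall x, ~~ e b x} ->
    peelable e k S -> peelable e k.+1 (b |: (a |: S)).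

Definition degree_in (T : finType) (e : rel T) (S : {set T}) (x : T) : nat :=
  #|[set y in S | e x y]|.

Section Structure.
Variables (T : finType) (e : rel T).
Hypotheses (e_sym : symmetric e) (e_irr : irreflexive e).

Lemma degree_in_lt (S : {set T}) x : x \in S -> (degree_in e S x < #|S|)%N.
Proof.
move=> xS; rewrite (cardsD1 x S) xS add1n ltnS.
apply/subset_leq_card/subsetP => y; rewrite !inE => /andP[yS exy].
rewrite yS andbT; apply/eqP => yx; by rewrite yx e_irr in exy.
Qed.

Lemma degree_in_full (S : {set T}) x y : x \in S -> y \in S -> y != x ->
  degree_in e S x = #|S|.-1 -> e x y.
Proof.
move=> xS yS yx dx.
have sub : [set z in S | e x z] \subset S :\ x.
  apply/subsetP => z; rewrite !inE => /andP[zS exz].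
  rewrite zS andbT; apply/eqP => zx; by rewrite zx e_irr in exz.
have /eqP eqS : [set z in S | e x z] == S :\ x.
  rewrite eqEcard sub /= -/(degree_in e S x) dx.
  by rewrite (cardsD1 x S) xS add1n.
have : y \in S :\ x by rewrite !inE yx.
by rewrite -eqS inE => /andP[].
Qed.

Lemma degree_in1 (S : {set T}) x y z :
  y \in S -> z \in S -> e x y -> e x z -> degree_in e S x = 1%N -> z = y.
Proof.
move=> yS zS exy exz /eqP/cards1P[w Ew].
have /set1P-> : z \in [set w] by rewrite -Ew !inE zS.
by have /set1P-> : y \in [set w] by rewrite -Ew !inE yS.
Qed.

(* At most one coincidence among #|S| degrees lying in {1, ..., #|S|-1} forces
   every value to be attained. *)
Lemma degree_in_surj (S : {set T}) u v d :
  {in S, forall x, (0 < degree_in e S x)%N} ->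
  {in S &, forall x y, x != y -> degree_in e S x = degree_in e S y ->
     [set x; y] = [set u; v]} ->
  (0 < d < #|S|)%N -> exists2 x, x \in S & degree_in e S x = d.
Proof.
move=> pos inj hd.
(* Every coincidence of degrees involves [u], so dropping [u] leaves at least #|S| - 1 distinct
   values in a range of that size. *)
pose s := [seq degree_in e S x | x <- enum (S :\ u)].
have us : uniq s.
  rewrite map_inj_in_uniq ?enum_uniq // => x y.
  rewrite !mem_enum !inE => /andP[xu xS] /andP[yu yS] dxy.
  apply/eqP; apply: contraTT isT => xy.
  have := inj x y xS yS xy dxy.
  move=> /setP/(_ u); rewrite !inE eqxx (eq_sym u) (negbTE xu) eq_sym.
  by rewrite (negbTE yu).
have sub : {subset s <= iota 1 #|S|.-1}.
  move=> i /mapP[x]; rewrite mem_enum !inE => /andP[_ xS] ->.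
  have := degree_in_lt xS; have := pos x xS.
  by rewrite mem_iota; clear; lia.
have szs : (size (iota 1 #|S|.-1) <= size s)%N.
  by rewrite size_iota size_map -cardE (cardsD1 u S); clear; lia.
have [_ /(_ d)] := uniq_min_size us sub szs.
rewrite mem_iota; have -> : (0 < d < 1 + #|S|.-1)%N by move: hd; clear; lia.
move=> /mapP[x]; rewrite mem_enum !inE => /andP[_ xS] ->.
by exists x.
Qed.

(** Positive degrees stand in for connectedness in the induction. After deleting [a] and [b] every
    remaining degree drops by exactly one, so coincidences are preserved and [u], [v] stay the
    same. *)
Lemma antiregular_peelable k (S : {set T}) u v :
  #|S| = (2 * k)%N ->
  {in S, forall x, (0 < degree_in e S x)%N} ->
  {in S &, forall x y, x != y -> degree_in e S x = degree_in e S y ->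
     [set x; y] = [set u; v]} ->
  peelable e k S.
Proof.
elim: k S => [|k IH] S cS pos inj.
  move/eqP: cS; rewrite muln0 cards_eq0 => /eqP->; exact: peelable0.
have surj := degree_in_surj pos inj.
have [a aS da] : exists2 x, x \in S & degree_in e S x = #|S|.-1.
  by apply: surj; rewrite cS; clear; lia.
have [b bS [ba db]] : exists2 b, b \in S & b != a /\ degree_in e S b = 1%N.
  (* On two vertices [surj] could return [a] itself as the vertex of degree 1, so [b] is taken to be
     the other vertex. *)
  case: k {IH} cS => [|k] cS.
    have /card_gt0P[b] : (0 < #|S :\ a|)%N.
      by move: cS; rewrite (cardsD1 a S) aS; clear; lia.
    rewrite !inE => /andP[ba bS]; exists b => //; split=> //.
    by move: (pos b bS) (degree_in_lt bS); rewrite cS; clear; lia.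
  have [b bS db] : exists2 x, x \in S & degree_in e S x = 1%N.
    by apply: surj; rewrite cS; clear; lia.
  exists b => //; split=> //; apply/eqP => ba.
  by move: da; rewrite -ba db cS; clear; lia.
have eab : e a b by apply: (degree_in_full aS bS ba da).
pose S' := S :\ b :\ a.
have defS : S = b |: (a |: S').
  by rewrite /S' setD1K ?setD1K // !inE eq_sym ba.
have aS' : a \notin S' by rewrite !inE eqxx.
have bS' : b \notin a |: S' by rewrite !inE eqxx (negbTE ba) !andbF.
have cS' : #|S'| = (2 * k)%N.
  by move: cS; rewrite defS cardsU1 bS' cardsU1 aS'; clear; lia.
have S'S x : x \in S' -> [/\ x \in S, x != a & x != b].
  by rewrite !inE => /and3P[].
have eaS' : {in S', forall x, e a x}.
  by move=> x /S'S[xS xa _]; apply: (degree_in_full aS xS xa da).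
have ebS y : y \in S -> y != a -> ~~ e b y.
  move=> yS; apply: contraNN => eby.
  by apply/eqP; apply: (degree_in1 aS yS _ eby db); rewrite e_sym.
have dS' x : x \in S' -> degree_in e S x = (degree_in e S' x).+1.
  move=> xS'; have [xS xa xb] := S'S x xS'.
  rewrite /degree_in.
  have -> : [set y in S | e x y] = a |: [set y in S' | e x y].
    apply/setP => y; rewrite !inE.
    have [-> | ya] /= := eqVneq y a; first by rewrite aS e_sym eaS'.
    have [-> | yb] //= := eqVneq y b.
    by rewrite e_sym (negbTE (ebS _ xS xa)) andbF.
  by rewrite cardsU1 !inE eqxx.
rewrite defS; apply: peelableS => //.
  by move=> x /S'S[xS xa _]; apply: ebS.
apply: IH => //.
  (* Two pendant vertices b and x would leave no vertex of degree #|S| - 2. *)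
  move=> x xS'; have [xS xa xb] := S'S x xS'.
  rewrite lt0n; apply/eqP => d0; have dx := dS' x xS'; rewrite d0 in dx.
  have k0 : (0 < k)%N.
    by have : (0 < #|S'|)%N by [apply/card_gt0P; exists x]; rewrite cS'; clear; lia.
  have [z zS dz] : exists2 x, x \in S & degree_in e S x = #|S|.-2.
    by apply: surj; rewrite cS; move: k0; clear; lia.
  have za : z != a by apply/eqP => za; move: da k0; rewrite -za dz cS; clear; lia.
  have zb : z != b by apply/eqP => zb; move: db k0; rewrite -zb dz cS; clear; lia.
  have zx : z != x by apply/eqP => zx; move: dx k0; rewrite -zx dz cS; clear; lia.
  have ezx : ~~ e z x.
    apply: contraNN za => ezx; apply/eqP.
    apply: (degree_in1 aS zS _ _ dx); last by rewrite e_sym.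
    by rewrite e_sym eaS'.
  (* [z] is adjacent to none of [b], [x] and itself, so its degree is at most #|S| - 3. *)
  have : (degree_in e S z <= #|S :\ b :\ x :\ z|)%N.
    apply/subset_leq_card/subsetP => y; rewrite !inE => /andP[yS ezy].
    rewrite yS andbT; apply/and3P; split; apply/eqP => Ey; subst y.
    - by rewrite e_irr in ezy.
    - by rewrite ezy in ezx.
    - by rewrite e_sym (negbTE (ebS _ zS za)) in ezy.
  have := cardsD1 b S; rewrite bS.
  have := cardsD1 x (S :\ b); rewrite !inE xb xS.
  have := cardsD1 z (S :\ b :\ x); rewrite !inE zb zx zS /=.
  rewrite dz; clear; lia.
move=> x y xS' yS' xy dxy.
have [xS _ _] := S'S x xS'; have [yS _ _] := S'S y yS'.
by apply: inj => //; rewrite !dS' // dxy.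
Qed.

End Structure.

(** * Eigenvector equations and their reduction to a linear recursion *)

Section Eigenvectors.
Variables (R : fieldType) (T : finType) (e : rel T).
Hypotheses (e_sym : symmetric e) (e_irr : irreflexive e).
Variable lambda : R.
Hypotheses (lambda_neq0 : lambda != 0) (lambda_neqN1 : lambda + 1 != 0).

(* The eigenvector equations on S, where s is the contribution of the
   deleted dominating vertices. *)
Definition eigen_on (S : {set T}) (s t : R) (x : T -> R) : Prop :=
  t = s + \sum_(y in S) x y /\
  {in S, forall v, s + \sum_(y in S | e v y) x y = lambda * x v}.

(** The two quotients are the forced values of [x a] and [x b]; the second one uses the updated
    [s]. *)
Definition peel_step (p : R * R) : R * R :=
  let s := p.1 + p.2 / (lambda + 1) in (s, p.2 - s / lambda).

(** Row [a] sees everything but itself, so [t - x a = lambda * x a]. Row [b] sees only [a] besides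
    the constant [s]. Every other row sees [a] and not [b], so [x a] joins [s], while only [x b]
    leaves the total [t]. *)
Lemma eigen_on_peel (S : {set T}) a b s t (x : T -> R) :
  a \notin S -> b \notin a |: S -> e a b ->
  {in S, forall y, e a y} -> {in S, forall y, ~~ e b y} ->
  eigen_on (b |: (a |: S)) s t x <->
  [/\ (lambda + 1) * x a = t, lambda * x b = s + x a &
      eigen_on S (s + x a) (t - x b) x].
Proof.
move=> aS baS eab eaS ebS.
have sumE : \sum_(y in b |: (a |: S)) x y = x b + (x a + \sum_(y in S) x y).
  by rewrite !big_setU1.
have bS : b \notin S by move: baS; rewrite !inE negb_or => /andP[].
have ba : b != a by move: baS; rewrite !inE negb_or => /andP[].
have sumeE v : \sum_(y in b |: (a |: S) | e v y) x y =
   (if e v b then x b else 0) + ((if e v a then x a else 0)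
     + \sum_(y in S | e v y) x y).
  have condE (A : {set T}) : \sum_(y in A | e v y) x y =
      \sum_(y in A) if e v y then x y else 0 by exact: big_mkcondr.
  by rewrite !condE !big_setU1.
have rowa : \sum_(y in b |: (a |: S) | e a y) x y = x b + \sum_(y in S) x y.
  rewrite sumeE eab e_irr add0r; congr (_ + _).
  by apply: eq_bigl => y; case: (boolP (y \in S)) => //= /eaS.
have rowb : \sum_(y in b |: (a |: S) | e b y) x y = x a.
  rewrite sumeE e_irr e_sym eab add0r big_pred0 ?addr0 // => y.
  by case: (boolP (y \in S)) => //= /ebS/negbTE.
have rowv v : v \in S ->
    \sum_(y in b |: (a |: S) | e v y) x y = x a + \sum_(y in S | e v y) x y.
  move=> vS; rewrite sumeE (e_sym v b) (negbTE (ebS v vS)) (e_sym v a) eaS //.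
  by rewrite add0r.
split=> [[tE eqs]|[xa xb [tE eqs]]].
  have /eqs : a \in b |: (a |: S) by rewrite !inE eqxx orbT.
  rewrite rowa => Ea.
  have /eqs : b \in b |: (a |: S) by rewrite !inE eqxx.
  rewrite rowb => Eb.
  split=> //.
    by rewrite mulrDl -Ea tE sumE; ring.
  split; first by rewrite tE sumE; ring.
  move=> v vS; rewrite -addrA -rowv //; apply: eqs.
  by rewrite !inE vS !orbT.
split.
  by rewrite sumE; move: tE => /(canRL (subrK _)) ->; ring.
move=> v; rewrite !inE => /or3P[/eqP->|/eqP->|vS].
- by rewrite rowb.
- rewrite rowa; move/(canRL (subrK _)): tE; rewrite -xa => E.
  by apply: (addIr (x a)); rewrite -[X in _ = _ + X]mul1r -mulrDl E; ring.
- by rewrite rowv // addrA eqs.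
Qed.

(** With [s = t = 0] each deletion forces [x a = x b = 0] and keeps both parameters zero. This later
    excludes eigenvectors of total 0. *)
Lemma eigen_on_zero k (S : {set T}) x :
  peelable e k S -> eigen_on S 0 0 x -> {in S, forall v, x v = 0}.
Proof.
elim=> [_ v|{}k {}S a b aS baS eab eaS ebS _ IH]; first by rewrite inE.
move/(eigen_on_peel _ _ _ aS baS eab eaS ebS) => [xa xb].
have {}xa : x a = 0.
  by apply/eqP; move/eqP: xa; rewrite mulf_eq0 (negbTE lambda_neqN1).
have {}xb : x b = 0.
  apply/eqP; move/eqP: xb.
  by rewrite xa addr0 mulf_eq0 (negbTE lambda_neq0).
rewrite xa xb addr0 subr0 => /IH xS v.
by rewrite !inE => /or3P[/eqP->|/eqP->|/xS].
Qed.

Lemma eigen_on_eq (S : {set T}) s t x y :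
  {in S, x =1 y} -> eigen_on S s t x -> eigen_on S s t y.
Proof.
move=> xy [tE eqs]; split.
  by rewrite tE; congr (_ + _); apply: eq_bigr => v /xy.
move=> v vS; rewrite -(xy v vS) -eqs //; congr (_ + _).
by apply: eq_bigr => w /andP[/xy].
Qed.

(** On the empty set only [t = s] remains. Each deletion before that fixes [x a] and [x b], and
    these values extend any solution on the smaller set. *)
Lemma eigen_on_exists k (S : {set T}) s t :
  peelable e k S ->
  (exists x, eigen_on S s t x) <->
  (iter k peel_step (s, t)).1 = (iter k peel_step (s, t)).2.
Proof.
move=> pS; elim: pS s t => [|{}k {}S a b aS baS eab eaS ebS _ IH] s t.
  split=> /= [[x [-> _]]|->]; first by rewrite big_set0 addr0.
  by exists (fun=> 0); split=> [|v]; rewrite ?big_set0 ?addr0 ?inE.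
have bS : b \notin S by move: baS; rewrite !inE negb_or => /andP[].
have ba : b != a by move: baS; rewrite !inE negb_or => /andP[].
have peelE := eigen_on_peel _ _ _ aS baS eab eaS ebS.
rewrite iterSr /peel_step /= -/peel_step.
split=> [[x /peelE[xa xb Ex]]|/IH[x Ex]].
  have Ea : x a = t / (lambda + 1) by rewrite -xa mulrC mulKf.
  apply/IH; exists x; rewrite -Ea.
  by have -> : (s + x a) / lambda = x b by rewrite -xb mulrC mulKf.
pose xa := t / (lambda + 1); pose xb := (s + xa) / lambda.
pose y v := if v == a then xa else if v == b then xb else x v.
have ya : y a = xa by rewrite /y eqxx.
have yb : y b = xb by rewrite /y (negbTE ba) eqxx.
exists y; apply/peelE; rewrite ya yb; split.
- by rewrite /xa mulrC divfK.
- by rewrite /xb mulrC divfK.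
- apply: eigen_on_eq Ex => v vS; rewrite /y.
  have [va|_] := eqVneq v a; first by rewrite -va vS in aS.
  by have [vb|//] := eqVneq v b; rewrite -vb vS in bS.
Qed.

Lemma eigen_on_scale (S : {set T}) s t r x :
  eigen_on S s t x -> eigen_on S (r * s) (r * t) (fun v => r * x v).
Proof.
move=> [tE eqs]; split; first by rewrite tE mulrDr mulr_sumr.
by move=> v vS; rewrite mulrCA -eqs // mulrDr mulr_sumr.
Qed.

End Eigenvectors.

(** [eigenvalue] refers to row vectors; symmetry turns the resulting column sums into sums over
    neighbours. *)
Lemma eigenvalue_adjacency (R : realType) (T : finType) (e : rel T)
    (lambda : R) : symmetric e ->
  eigenvalue (adjacency_mx R e) lambda <->
  exists2 x : T -> R, (forall v, \sum_(y | e v y) x y = lambda * x v) &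
    exists v, x v != 0.
Proof.
move=> e_sym.
have mulE (x : T -> R) j :
    \sum_i x (enum_val i) * adjacency_mx R e i j =
    \sum_(y | e (enum_val j) y) x y.
  rewrite [RHS]big_mkcond /= [RHS](reindex _ (onW_bij _ (enum_val_bij _))) /=.
  apply: eq_bigr => i _; rewrite mxE e_sym.
  by case: ifP; rewrite (mulr1, mulr0).
split=> [/eigenvalueP[x xM x0]|[x xE [v xv]]].
  exists (fun v => x 0 (enum_rank v)).
    move=> v; have := congr1 (fun m : 'rV_ _ => m 0 (enum_rank v)) xM.
    rewrite !mxE => <-.
    rewrite -[v in LHS]enum_rankK -(mulE (fun v => x 0 (enum_rank v))).
    by apply: eq_bigr => i _; rewrite enum_valK.
  have [i xi] : exists i, x 0 i != 0.
    apply/existsP; apply: contraNT x0; rewrite negb_exists => /forallP x0.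
    by apply/eqP/rowP => i; rewrite mxE; apply/eqP; move: (x0 i); rewrite negbK.
  by exists (enum_val i); rewrite enum_valK.
apply/eigenvalueP; exists (\row_i x (enum_val i)).
  apply/rowP => j; rewrite !mxE -xE -mulE.
  by apply: eq_bigr => i _; rewrite mxE.
apply: contraNneq xv => /rowP/(_ (enum_rank v)).
by rewrite !mxE enum_rankK => ->.
Qed.

(** Initially nothing is deleted, so [s = 0]. The total of an eigenvector is nonzero by
    [eigen_on_zero] and can be scaled to 1; conversely a vector of total 1 is nonzero. *)
Lemma eigenvalue_peelable (R : realType) (T : finType) (e : rel T) k
    (lambda : R) :
  symmetric e -> irreflexive e -> lambda != 0 -> lambda + 1 != 0 ->
  peelable e k [set: T] ->
  eigenvalue (adjacency_mx R e) lambda <->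
  (iter k (peel_step lambda) (0, 1)).1 = (iter k (peel_step lambda) (0, 1)).2.
Proof.
move=> e_sym e_irr l0 l1 pT.
rewrite eigenvalue_adjacency // -(eigen_on_exists e_sym e_irr l0 l1 0 1 pT).
have setTE v (x : T -> R) :
    \sum_(y in [set: T] | e v y) x y = \sum_(y | e v y) x y.
  by apply: eq_bigl => y; rewrite inE.
split=> [[x xE [v xv]]|[x [x1 xE]]].
  pose t := \sum_(y in [set: T]) x y.
  have Ex : eigen_on e lambda [set: T] 0 t x.
    by split=> [|w _]; rewrite add0r // setTE.
  have [t0|t0] := eqVneq t 0.
    rewrite t0 in Ex; move: xv.
    by rewrite (eigen_on_zero e_sym e_irr l0 l1 pT Ex) ?inE // eqxx.
  exists (fun v => t^-1 * x v).
  by have := eigen_on_scale t^-1 Ex; rewrite mulr0 mulVf.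
exists x.
  by move=> v; rewrite -xE ?inE // add0r setTE.
apply/existsP; apply: contraT; rewrite negb_exists => /forallP x0.
move/eqP: x1; rewrite big1 ?addr0 ?oner_eq0 // => v _.
by apply/eqP; move: (x0 v); rewrite negbK.
Qed.

(** * Chebyshev values and the solution of the recursion *)

(* Chebyshev polynomials of the second kind, shifted: cheb c n = U_{n-1}(c). *)
Fixpoint cheb (R : pzRingType) (c : R) (n : nat) : R :=
  match n with
  | 0 => 0
  | m.+1 => if m is p.+1 then 2 * c * cheb c m - cheb c p else 1
  end.

Lemma chebSS (R : pzRingType) (c : R) n :
  cheb c n.+2 = 2 * c * cheb c n.+1 - cheb c n.
Proof. by []. Qed.

Lemma sin_cheb (R : realType) (x : R) n :
  sin (n%:R * x) = cheb (cos x) n * sin x.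
Proof.
suff : sin (n%:R * x) = cheb (cos x) n * sin x /\
       sin (n.+1%:R * x) = cheb (cos x) n.+1 * sin x by case.
elim: n => [|n [IH IH1]]; first by rewrite !mul0r sin0 !mul1r.
split=> //; rewrite chebSS mulrBl -IH -mulrA -IH1.
have -> : n.+2%:R * x = n.+1%:R * x + x by rewrite -[n.+2]addn1 natrD; ring.
have -> : n%:R * x = n.+1%:R * x - x by rewrite -[n.+1]addn1 natrD; ring.
by rewrite sinD sinB; ring.
Qed.

(** By induction, |2cU - V| >= 2|U| - |V| > |U| for consecutive values V, U. *)
Lemma cheb_incr (R : realDomainType) (c : R) n :
  1 <= `|c| -> `|cheb c n| < `|cheb c n.+1|.
Proof.
move=> c1; elim: n => [|n IH]; first by rewrite normr0 normr1 ltr01.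
rewrite chebSS; apply: lt_le_trans (lerB_dist _ _).
rewrite !normrM (ger0_norm (ler0n _ 2)).
have := ler_peMl (normr_ge0 (cheb c n.+1)) c1; lra.
Qed.

(** Two consecutive zeros would propagate down to [cheb c 1 = 1]. *)
Lemma cheb_consecutive (R : nzRingType) (c : R) n :
  ~ (cheb c n.+1 = 0 /\ cheb c n = 0).
Proof.
elim: n => [[/eqP]|n IH [E2 E1]]; first by rewrite oner_eq0.
apply: IH; split=> //; apply/eqP; rewrite -oppr_eq0; apply/eqP.
by move: E2; rewrite chebSS E1 mulr0 add0r.
Qed.

(** The hypothesis on [c] says that the matrix of [peel_step lambda], of determinant 1, has trace
    -2c; its powers thus follow the Chebyshev recursion with alternating signs. *)
Lemma iter_peel_step (R : fieldType) (lambda c : R) n :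
  lambda != 0 -> lambda + 1 != 0 ->
  2 * (1 + c) = (lambda * (lambda + 1))^-1 ->
  iter n (peel_step lambda) (0, 1) =
  (- (-1) ^+ n * cheb c n / (lambda + 1),
   (-1) ^+ n * (cheb c n.+1 + cheb c n)).
Proof.
move=> l0 l1 cE; elim: n => [|n IH].
  by rewrite /= expr0 mulr0 mul0r addr0 mulr1.
have cE' : 2 * c = (lambda * (lambda + 1))^-1 - 2 by rewrite -cE; ring.
rewrite iterS IH chebSS /peel_step /fst /snd cE' !exprS.
by congr (_, _); field; rewrite ?l0 ?l1.
Qed.

Lemma peel_end_condition (R : fieldType) (lambda c : R) n :
  lambda != 0 -> lambda + 1 != 0 ->
  2 * (1 + c) = (lambda * (lambda + 1))^-1 ->
  (iter n.+1 (peel_step lambda) (0, 1)).1 =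
    (iter n.+1 (peel_step lambda) (0, 1)).2 <->
  cheb c n.+1 = lambda * (cheb c n.+1 + cheb c n).
Proof.
move=> l0 l1 cE; rewrite (iter_peel_step _ l0 l1 cE) chebSS /fst /snd.
set U := cheb c n.+1; set V := cheb c n; set s := (-1) ^+ n.+1.
have s0 : s != 0 by rewrite signr_eq0.
have cE' : 2 * c = (lambda * (lambda + 1))^-1 - 2 by rewrite -cE; ring.
(* The two components differ by the desired equation times the invertible factor [s / lambda]. *)
have diffE : - s * U / (lambda + 1) - s * (2 * c * U - V + U) =
    s / lambda * (lambda * (U + V) - U).
  by rewrite cE'; field; rewrite l0 l1.
split=> [/eqP|UV]; last first.
  by apply/eqP; rewrite -subr_eq0 diffE -UV subrr mulr0.
rewrite -subr_eq0 diffE !mulf_eq0 invr_eq0 (negbTE l0) (negbTE s0) /=.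
by rewrite subr_eq0 => /eqP.
Qed.

Theorem theorem5p1 (R : realType) (k : nat) (hk : (1 <= k)%N)
    (T : finType) (e : rel T)
    (e_sym : symmetric e) (e_irr : irreflexive e)
    (card_T : #|T| = (2 * k)%N)
    (e_conn : connected_graph e) (e_anti : antiregular e)
    (lambda : R) (lambda_neq0 : lambda != 0) (lambda_neqN1 : lambda != -1) :
  let c : R := (1 - 2 * lambda - 2 * lambda ^+ 2)
                 / (2 * lambda * (lambda + 1)) in
  let theta : R := acos c in
  eigenvalue (adjacency_mx R e) lambda <->
  [/\ -1 <= c <= 1,
      sin (k%:R * theta) + sin ((k%:R - 1) * theta) != 0 &
      lambda = sin (k%:R * theta)
                 / (sin (k%:R * theta) + sin ((k%:R - 1) * theta))].
Proof.
move=> c theta.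
have l1 : lambda + 1 != 0 by rewrite addr_eq0.
have cE : 2 * (1 + c) = (lambda * (lambda + 1))^-1.
  by rewrite /c; field; rewrite lambda_neq0 l1.
case: k hk card_T => // n _ card_T.
have pT : peelable e n.+1 [set: T].
  have degE x : degree_in e [set: T] x = degree e x.
    by apply: eq_card => y; rewrite !inE.
  have [u [v [_ _ uv]]] := e_anti.
  apply: (@antiregular_peelable _ _ e_sym e_irr _ _ u v).
  - by rewrite cardsT.
  - move=> x _; have [y yx] : exists y, y != x.
      have /card_gt0P[y] : (0 < #|[set: T] :\ x|)%N.
        have := cardsD1 x [set: T].
        by rewrite cardsT card_T inE; clear; lia.
      by rewrite !inE andbT => yx; exists y.
    (* The first edge of a path from [x] to another vertex provides a neighbour. *)
    have /connectP[[|z p] /=] := e_conn x y.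
      by move=> _ yE; rewrite yE eqxx in yx.
    move=> /andP[exz _] _; apply/card_gt0P; exists z.
    by rewrite !inE.
  - by move=> x y _ _ xy; rewrite !degE; apply: uv.
rewrite (eigenvalue_peelable e_sym e_irr lambda_neq0 l1 pT).
rewrite (peel_end_condition _ lambda_neq0 l1 cE).
set U := cheb c n.+1; set V := cheb c n.
(* The bound on [c] is needed for [cos (acos c) = c]. *)
have sinE : -1 <= c <= 1 -> sin (n.+1%:R * theta) = U * sin theta /\
    sin ((n.+1%:R - 1) * theta) = V * sin theta.
  move=> c1; have -> : n.+1%:R - 1 = n%:R :> R by rewrite -natr1 addrK.
  by rewrite !sin_cheb /theta acosK // in_itv.
split=> [UE|[c1 + lE]]; last first.
  have [sU sV] := sinE c1; move: lE.
  rewrite sU sV -mulrDl => lE; rewrite mulf_eq0 negb_or => /andP[UV st].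
  by rewrite {1}lE -mulf_div divff // mulr1 divfK.
(* If |c| >= 1, then (1 - lambda) U = lambda V with |V| < |U| gives |1 - lambda| < |lambda|, so
   lambda > 1/2 and lambda (lambda + 1) > 3/4. Hence 0 < 2 (1 + c) < 4/3, which puts [c] strictly
   between -1 and -1/3. *)
have c1 : `|c| < 1.
  rewrite ltNge; apply/negP => c1.
  have VU : `|V| < `|U| := cheb_incr n c1.
  have lV : `|1 - lambda| * `|U| = `|lambda| * `|V|.
    by rewrite -!normrM; congr `|_|; rewrite mulrBl mul1r {1}UE; ring.
  have U0 : 0 < `|U| by apply: le_lt_trans VU.
  have l0 : 0 < `|lambda| by rewrite normr_gt0.
  have : `|1 - lambda| < `|lambda|.
    by rewrite -(ltr_pM2r U0) lV ltr_pM2l.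
  move=> ll; have l2 : 1 / 2 < lambda.
    move: ll; case: (ger0P lambda); case: (ger0P (1 - lambda)); lra.
  have l3 : 0 < lambda * (lambda + 1) - 3 / 4 by nra.
  have i0 : 0 < 2 * (1 + c) by rewrite cE invr_gt0; lra.
  have i1 : 2 * (1 + c) * (lambda * (lambda + 1)) = 1.
    by rewrite cE mulVf // mulf_neq0.
  have := mulr_gt0 i0 l3; rewrite mulrBr i1.
  by move: c1; case: (ger0P c); lra.
move: c1; rewrite ltr_norml => /andP[cN1 c1].
have c11 : -1 <= c <= 1 by rewrite !ltW.
have [-> ->] := sinE c11.
have st : sin theta != 0.
  by rewrite /theta sin_acos // sqrtr_eq0 -ltNge; nra.
have UV : U + V != 0.
  apply/eqP => UV0; have U0 : U = 0 by rewrite UE UV0 mulr0.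
  by apply: (@cheb_consecutive R c n); split=> //; rewrite -UV0 U0 add0r.
rewrite -mulrDl; split=> //; first by rewrite mulf_neq0.
by rewrite -mulf_div divff // mulr1 {1}UE mulfK.
Qed.
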